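(* Let $\mathcal{G}$ be any class of groups. The class of all graphs $\Gamma$ such that the Binary Cycle Test is valid for every gain graph $(\Gamma,g,G)$ with underlying graph $\Gamma$ and gain group $G\in\mathcal{G}$ is minor closed. Likewise, the class of all graphs $\Gamma$ such that the Circle Test is valid for every gain graph $(\Gamma,g,G)$ with underlying graph $\Gamma$ and gain group $G\in\mathcal{G}$ is minor closed.
   Context: Graphs may be infinite and may have loops and multiple edges. A gain graph $(\Gamma,g,G)$ is a graph $\Gamma=(V,E)$, a group $G$ (the gain group), and a homomorphism $g:F(E)\to G$ from the free group on $E$ (the gain function). Each edge $e$ has an arbitrary fixed orientation and $e^{-1}$ denotes the same edge in the opposite direction, so $g(e^{-1})=g(e)^{-1}$; the gain of a walk is the product, in order, of the gains of its (directed) edges. A closed walk is simple if it is nontrivial and repeats no vertex or edge, except that its initial and final vertices coincide. A circle is the edge set of a simple closed walk (a loop is a circle of length 1; a pair of parallel links is a circle of length 2). The gain graph is balanced if every simple closed walk has gain $1$. $Z_1(\Gamma;\mathbb{Z}_2)$ is the group of binary cycles: finite edge sets having even degree at every vertex (a loop counts twice), under symmetric difference. A cyclic orientation of a binary cycle $b$ is any closed walk $\tilde b$ in $\Gamma$ whose edge multiset, reduced modulo 2, is $b$ (so $\tilde b$ may use edges outside $b$ an even number of times). A cyclic orientation of a set $B$ of binary cycles is a choice of a cyclic orientation $\tilde b$ for each $b\in B$. A basis $B$ of $Z_1(\Gamma;\mathbb{Z}_2)$ passes the Binary Cycle Test if it has a cyclic orientation all of whose members have gain $1$. The Binary Cycle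 Test is valid for $(\Gamma,g,G)$ if the existence of a basis $B$ that passes the Binary Cycle Test implies that $(\Gamma,g,G)$ is balanced. The Circle Test is the same test restricted to bases $B$ all of whose members are circles, each circle being cyclically oriented in the natural way as a simple closed walk; i.e., the Circle Test is valid for $(\Gamma,g,G)$ if the existence of a basis of $Z_1(\Gamma;\mathbb{Z}_2)$ consisting of circles of gain $1$ implies that $(\Gamma,g,G)$ is balanced. A minor of a graph is the result of any finite sequence of operations of contracting edge sets and taking subgraphs (the edge sets contracted and the subgraphs may be infinite). A class of graphs (up to isomorphism) is minor closed if it contains every minor of each of its members. *)

(* Defs.v *)
From HB Require Import structures.
From mathcomp Require Import all_boot.
From mathcomp Require Import generic_quotient finmap boolp classical_sets.

Set Implicit Arguments.
Unset Strict Implicit.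
Unset Printing Implicit Defensive.

Import Monoid.Theory.
Local Open Scope quotient_scope.
Local Open Scope group_scope.

(** * Free groups *)

(** A word on [E] is a finite product of letters; [(e, true)] stands for [e] and
    [(e, false)] for its inverse.  The free group is the quotient of words
    by the congruence generated by cancelling two adjacent inverse letters. *)
Section FreeGroup.
Variable E : choiceType.
Implicit Types u v w : seq (E * bool).

Definition opp_letter (a : E * bool) : E * bool := (a.1, ~~ a.2).

Inductive free_eq : seq (E * bool) -> seq (E * bool) -> Prop :=
| free_eq_refl u : free_eq u u
| free_eq_sym u v : free_eq u v -> free_eq v u
| free_eq_trans u v w : free_eq u v -> free_eq v w -> free_eq u w
| free_eq_cancel u a v : free_eq (u ++ [:: a, opp_letter a & v]) (u ++ v).

Definition free_eqb u v : bool := `[< free_eq u v >].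

Lemma free_eqbP u v : reflect (free_eq u v) (free_eqb u v).
Proof. exact: asboolP. Qed.

Lemma free_eqb_refl : reflexive free_eqb.
Proof. by move=> u; apply/free_eqbP/free_eq_refl. Qed.

Lemma free_eqb_sym : symmetric free_eqb.
Proof. by move=> u v; apply/free_eqbP/free_eqbP => /free_eq_sym. Qed.

Lemma free_eqb_trans : transitive free_eqb.
Proof.
move=> v u w /free_eqbP uv /free_eqbP vw.
by apply/free_eqbP; apply: free_eq_trans vw.
Qed.

Canonical free_eqb_equiv :=
  EquivRel free_eqb free_eqb_refl free_eqb_sym free_eqb_trans.

Definition free_group := {eq_quot free_eqb}.

HB.instance Definition _ := Choice.on free_group.
HB.instance Definition _ := EqQuotient.on free_group.

Definition inv_word w := rev (map opp_letter w).

Definition fg_one : free_group := \pi_free_group [::].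
Definition fg_mul (x y : free_group) : free_group :=
  \pi_free_group (repr x ++ repr y).
Definition fg_inv (x : free_group) : free_group :=
  \pi_free_group (inv_word (repr x)).

Lemma fg_piP u v : free_eq u v <-> \pi_free_group u = \pi_free_group v.
Proof.
by split=> [/free_eqbP uv | /eqquotP uv]; [apply/eqquotP | apply/free_eqbP].
Qed.

Lemma free_eq_repr u : free_eq (repr (\pi_free_group u)) u.
Proof. by apply/fg_piP; rewrite reprK. Qed.

Lemma free_eq_ctx u v s t : free_eq u v -> free_eq (s ++ u ++ t) (s ++ v ++ t).
Proof.
elim=> {u v} [u | u v _ | u v w _ uv _ vw | u a v].
- exact: free_eq_refl.
- exact: free_eq_sym.
- exact: free_eq_trans vw.
- by have := free_eq_cancel (s ++ u) a (v ++ t); rewrite -!catA.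
Qed.

Lemma free_eq_cat u u' v v' :
  free_eq u u' -> free_eq v v' -> free_eq (u ++ v) (u' ++ v').
Proof.
move=> uu vv; apply: (@free_eq_trans _ (u' ++ v)).
  exact: (free_eq_ctx [::] v uu).
by have := free_eq_ctx u' [::] vv; rewrite !cats0.
Qed.

Lemma opp_letterK : involutive opp_letter.
Proof. by case=> e b; rewrite /opp_letter /= negbK. Qed.

Lemma inv_wordK : involutive inv_word.
Proof.
by move=> w; rewrite /inv_word map_rev revK -map_comp (eq_map opp_letterK) map_id.
Qed.

Lemma free_eq_mulV w : free_eq (w ++ inv_word w) [::].
Proof.
elim/last_ind: w => [|w a IH]; first exact: free_eq_refl.
apply: free_eq_trans IH.
by rewrite /inv_word map_rcons rev_rcons cat_rcons; apply: free_eq_cancel.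
Qed.

Lemma pi_mul u v :
  fg_mul (\pi_free_group u) (\pi_free_group v) = \pi_free_group (u ++ v).
Proof. by apply/fg_piP/free_eq_cat; apply: free_eq_repr. Qed.

Lemma fg_mulA : associative fg_mul.
Proof.
elim/quotW=> u; elim/quotW=> v; elim/quotW=> w.
by rewrite (pi_mul v w) (pi_mul u v) (pi_mul u) (pi_mul _ w) catA.
Qed.

Lemma fg_mul1 : left_id fg_one fg_mul.
Proof. by elim/quotW=> u; rewrite pi_mul. Qed.

Lemma fg_mulr1 : right_id fg_one fg_mul.
Proof. by elim/quotW=> u; rewrite pi_mul cats0. Qed.

Lemma fg_mulrV : right_inverse fg_one fg_inv fg_mul.
Proof.
move=> x; rewrite -[X in fg_mul X _]reprK pi_mul; apply/fg_piP.
exact: free_eq_mulV.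
Qed.

Lemma fg_mulV : left_inverse fg_one fg_inv fg_mul.
Proof.
move=> x; rewrite -[X in fg_mul _ X]reprK pi_mul; apply/fg_piP.
by rewrite -{2}[repr x]inv_wordK; apply: free_eq_mulV.
Qed.

HB.instance Definition _ := isGroup.Build free_group
  fg_mulA fg_mul1 fg_mulr1 fg_mulV fg_mulrV.

Definition fg_gen (e : E) : free_group := \pi_free_group [:: (e, true)].

End FreeGroup.

(** * Graphs *)

(** Possibly infinite multigraphs with loops; [src] and [tgt] record the
    arbitrary fixed orientation of each edge. *)
Record graph := Graph {
  vertex : choiceType;
  edge : choiceType;
  src : edge -> vertex;
  tgt : edge -> vertex
}.

(** Graph isomorphisms need not respect the fixed orientations. *)
Definition graph_iso (X Y : graph) : Prop :=
  exists (fV : vertex X -> vertex Y) (fE : edge X -> edge Y),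
    [/\ bijective fV, bijective fE &
        forall e, (src (fE e) = fV (src e) /\ tgt (fE e) = fV (tgt e)) \/
                  (src (fE e) = fV (tgt e) /\ tgt (fE e) = fV (src e))].

Section Walks.
Variable X : graph.

(** A directed edge: [(e, true)] is [e] in its fixed orientation and
    [(e, false)] is the same edge in the opposite direction. *)
Definition dart : Type := (edge X * bool)%type.

Definition dsrc (d : dart) : vertex X := if d.2 then src d.1 else tgt d.1.
Definition dtgt (d : dart) : vertex X := if d.2 then tgt d.1 else src d.1.

Fixpoint walk (u : vertex X) (w : seq dart) (v : vertex X) : bool :=
  if w is d :: w' then (dsrc d == u) && walk (dtgt d) w' v else u == v.

Definition walk_edges (w : seq dart) : seq (edge X) := [seq d.1 | d <- w].

Definition closed_walk (w : seq dart) : Prop := exists v, walk v w v.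

(** For a closed walk, [map dsrc w] lists its vertices with the final one
    (equal to the initial one) omitted. *)
Definition simple_closed_walk (w : seq dart) : Prop :=
  [/\ closed_walk w, w <> [::], uniq (map dsrc w) & uniq (walk_edges w)].

End Walks.

(** * Minors *)

Section Contraction.
Variables (X : graph) (S : set (edge X)).

Definition joined (u v : vertex X) : bool :=
  `[< exists w : seq (dart X),
        walk u w v /\ (forall e, e \in walk_edges w -> S e) >].

Lemma joined_refl : reflexive joined.
Proof. by move=> u; apply/asboolP; exists [::]; rewrite /= eqxx. Qed.

Lemma walk_cat u v t (p q : seq (dart X)) :
  walk u p v -> walk v q t -> walk u (p ++ q) t.
Proof.
elim: p u => [u /eqP -> // | d p IH u] /= /andP[-> dp] vq.
exact: IH.
Qed.

Lemma walk_rev u v (p : seq (dart X)) :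
  walk u p v -> walk v (rev (map (@opp_letter _) p)) u.
Proof.
elim: p u => [u /eqP -> /= | [e b] p IH u] /=; first exact: eqxx.
move=> /andP[/eqP <- /IH pv]; rewrite rev_cons -cats1.
apply: (walk_cat pv); rewrite /= /dsrc /dtgt /=.
by case: b {pv} => /=; rewrite !eqxx.
Qed.

Lemma joined_sym : symmetric joined.
Proof.
suff H u v : joined u v -> joined v u by move=> u v; apply/idP/idP; apply: H.
move=> /asboolP[w [uv Sw]]; apply/asboolP.
exists (rev (map (@opp_letter _) w)); split; first exact: walk_rev.
move=> e; rewrite /walk_edges map_rev mem_rev -map_comp => we.
by apply: Sw; rewrite /walk_edges (eq_map (g := fst \o @opp_letter _)).
Qed.

Lemma joined_trans : transitive joined.
Proof.
move=> v u t /asboolP[p [uv Sp]] /asboolP[q [vt Sq]].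
apply/asboolP; exists (p ++ q); split; first exact: walk_cat vt.
by move=> e; rewrite /walk_edges map_cat mem_cat => /orP[/Sp | /Sq].
Qed.

Canonical joined_equiv :=
  EquivRel joined joined_refl joined_sym joined_trans.

(** Contracting [S] identifies the vertices of each component of [(V, S)] and
    removes the edges of [S]; the other edges remain (possibly as loops). *)
Definition contract : graph :=
  @Graph {eq_quot joined} (set_type (~` S)%classic)
    (fun e => \pi_{eq_quot joined} (src (val e)))
    (fun e => \pi_{eq_quot joined} (tgt (val e))).

End Contraction.

Section Subgraph.
Variables (X : graph) (W : set (vertex X)) (F : set (edge X)).
Hypothesis srcW : forall e : F, src (val e) \in W.
Hypothesis tgtW : forall e : F, tgt (val e) \in W.

Definition subgraph : graph :=
  @Graph (set_type W) (set_type F)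
    (fun e => exist _ (src (val e)) (srcW e))
    (fun e => exist _ (tgt (val e)) (tgtW e)).

End Subgraph.

(** [minor X Y] : up to isomorphism, [Y] is a minor of [X]. *)
Inductive minor (X : graph) : graph -> Prop :=
| minor_refl : minor X X
| minor_contract Y (S : set (edge Y)) : minor X Y -> minor X (contract S)
| minor_subgraph Y (W : set (vertex Y)) (F : set (edge Y))
    (srcW : forall e : F, src (val e) \in W)
    (tgtW : forall e : F, tgt (val e) \in W) :
    minor X Y -> minor X (subgraph srcW tgtW)
| minor_iso Y Z : minor X Y -> graph_iso Y Z -> minor X Z.

Definition minor_closed (C : graph -> Prop) : Prop :=
  forall X Y, C X -> minor X Y -> C Y.

(** * Binary cycles *)

Section SymDiff.
Variable T : choiceType.
Implicit Types A B : {fset T}.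

Definition fsymdiff A B : {fset T} := ((A `\` B) `|` (B `\` A))%fset.

Lemma in_fsymdiff A B x : (x \in fsymdiff A B) = (x \in A) (+) (x \in B).
Proof. by rewrite !inE; case: (x \in A); case: (x \in B). Qed.

Lemma fsymdiffA : associative fsymdiff.
Proof. by move=> A B C; apply/fsetP => x; rewrite !in_fsymdiff addbA. Qed.

Lemma fsymdiffC : commutative fsymdiff.
Proof. by move=> A B; apply/fsetP => x; rewrite !in_fsymdiff addbC. Qed.

Lemma fsymdiff0 : left_id (fset0 : {fset T}) fsymdiff.
Proof. by move=> A; apply/fsetP => x; rewrite in_fsymdiff in_fset0. Qed.

HB.instance Definition _ :=
  Monoid.isComLaw.Build {fset T} fset0 fsymdiff fsymdiffA fsymdiffC fsymdiff0.

End SymDiff.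

Section BinaryCycles.
Variable X : graph.
Implicit Types (b : {fset edge X}) (w : seq (dart X)).

Definition degree b (v : vertex X) : nat :=
  (\sum_(e <- b) ((src e == v) + (tgt e == v)))%N.

Definition binary_cycle b : Prop := forall v, ~~ odd (degree b v).

(** A basis of the binary cycles as a vector space over the field with two
    elements: linear combinations are sums of finite subsets. *)
Definition is_basis (B : set {fset edge X}) : Prop :=
  [/\ forall b, B b -> binary_cycle b,
      forall z, binary_cycle z ->
        exists2 S : {fset {fset edge X}},
          (forall b, b \in S -> B b) & \big[@fsymdiff _/fset0]_(b <- S) b = z &
      forall S : {fset {fset edge X}}, (forall b, b \in S -> B b) ->
        \big[@fsymdiff _/fset0]_(b <- S) b = fset0 -> S = fset0].

Definition edges_mod2 w : {fset edge X} :=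
  [fset e in walk_edges w | odd (count_mem e (walk_edges w))]%fset.

Definition cyclic_orientation b w : Prop :=
  closed_walk w /\ edges_mod2 w = b.

(** The natural cyclic orientations of a circle. *)
Definition circle_orientation b w : Prop :=
  simple_closed_walk w /\ [fset e in walk_edges w]%fset = b.

Definition circle b : Prop := exists w, circle_orientation b w.

End BinaryCycles.

(** * Gain graphs *)

Definition gain_function (X : graph) (G : groupType) :=
  {multiplicative free_group (edge X) -> G}.

Section Gains.
Variables (X : graph) (G : groupType) (g : gain_function X G).

Definition dart_elt (d : dart X) : free_group (edge X) :=
  if d.2 then fg_gen d.1 else (fg_gen d.1)^-1.

Definition gain (w : seq (dart X)) : G := \prod_(d <- w) g (dart_elt d).

Definition balanced : Prop := forall w, simple_closed_walk w -> gain w = 1.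

Definition passes_binary_cycle_test (B : set {fset edge X}) : Prop :=
  exists tilde : {fset edge X} -> seq (dart X),
    (forall b, B b -> cyclic_orientation b (tilde b)) /\
    (forall b, B b -> gain (tilde b) = 1).

Definition passes_circle_test (B : set {fset edge X}) : Prop :=
  (forall b, B b -> circle b) /\
  exists tilde : {fset edge X} -> seq (dart X),
    (forall b, B b -> circle_orientation b (tilde b)) /\
    (forall b, B b -> gain (tilde b) = 1).

Definition binary_cycle_test_valid : Prop :=
  (exists2 B, is_basis B & passes_binary_cycle_test B) -> balanced.

Definition circle_test_valid : Prop :=
  (exists2 B, is_basis B & passes_circle_test B) -> balanced.

End Gains.

(* Main.v *)
From HB Require Import structures.
From mathcomp Require Import all_boot.
From mathcomp Require Import generic_quotient finmap boolp classical_sets.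
Require Import Defs.

(** Let [Y] be a minor of [X] and give [Y] a gain function.  Extend it to [X]:
    contracted edges get gain 1; among the deleted ones choose, by Zorn's lemma,
    a maximal set [D] whose addition creates no new binary cycle, and give [D]
    gain 1; every other deleted edge [e] lies on a circle [C_e] avoiding the
    other deleted edges outside [D], and gets the gain making [C_e] balanced.
    A basis passing the test for [Y] lifts to [X] by inserting simple paths in
    the contracted components, which keeps simple closed walks simple.  Together
    with a circle basis of the contracted subgraph and the circles [C_e] it is a
    basis for [X] that passes the test.  So [X] is balanced, and [Y] is too, as
    its simple closed walks lift with their gains. *)

Set Implicit Arguments.
Unset Strict Implicit.
Unset Printing Implicit Defensive.

Import Monoid.Theory.
Local Open Scope quotient_scope.
Local Open Scope group_scope.

(** * Linear algebra over the field with two elements, on finite sets *)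

Lemma mem_fset_pred (T : choiceType) (A : {fset T}) (P : pred T) x :
  (x \in [fset y in A | P y]%fset) = (x \in A) && P x.
Proof. by rewrite !inE. Qed.

Lemma fsymdiffxx (T : choiceType) (A : {fset T}) : fsymdiff A A = fset0.
Proof. by apply/fsetP => x; rewrite in_fsymdiff in_fset0 addbb. Qed.

Lemma fsymdiffK (T : choiceType) (A B : {fset T}) :
  fsymdiff A (fsymdiff A B) = B.
Proof. by rewrite fsymdiffA fsymdiffxx fsymdiff0. Qed.

(** A common element of [A] and [B] contributes [op x x] on the right, which [opxx] cancels. *)
Lemma big_fsymdiff (M : Type) (idx : M) (op : Monoid.com_law idx)
    (T : choiceType) (A B : {fset T}) (f : T -> M) :
    (forall x, op x x = idx) ->
  \big[op/idx]_(x <- fsymdiff A B) f x =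
  op (\big[op/idx]_(x <- A) f x) (\big[op/idx]_(x <- B) f x).
Proof.
move=> opxx; pose U := (A `|` B)%fset.
have ext (C : {fset T}) : (C `<=` U)%fset ->
    \big[op/idx]_(x <- C) f x =
    \big[op/idx]_(x <- U) (if x \in C then f x else idx).
  move=> CU; rewrite -(big_fset_incl _ CU); first by apply: eq_big_seq => x ->.
  by move=> x _ /negbTE ->.
rewrite (ext A) ?fsubsetUl // (ext B) ?fsubsetUr // (ext (fsymdiff A B)).
  rewrite -big_split; apply: eq_bigr => x _; rewrite in_fsymdiff.
  by case: (x \in A); case: (x \in B); rewrite /= ?opxx ?mulm1 ?mul1m.
by apply/fsubsetP => x; rewrite in_fsymdiff in_fsetU;
  case: (x \in A); case: (x \in B).
Qed.

Definition fsum (T : choiceType) (S : {fset {fset T}}) : {fset T} :=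
  \big[@fsymdiff _/fset0]_(b <- S) b.

Definition span (T : choiceType) (B : set {fset T}) (z : {fset T}) : Prop :=
  exists2 S : {fset {fset T}}, (forall b, b \in S -> B b) & fsum S = z.

(** The notion [is_basis] with the ambient space as a parameter, so that the cycles inside a given
    edge set can have a basis too. *)
Definition basis_of (T : choiceType) (P : {fset T} -> Prop)
    (B : set {fset T}) : Prop :=
  [/\ forall b, B b -> P b,
      forall z, P z -> span B z &
      forall S : {fset {fset T}},
        (forall b, b \in S -> B b) -> fsum S = fset0 -> S = fset0].

Section LinearAlgebra.
Variable T : choiceType.
Implicit Types (B C : set {fset T}) (S : {fset {fset T}}) (z : {fset T}).

Lemma fsumD S1 S2 : fsum (fsymdiff S1 S2) = fsymdiff (fsum S1) (fsum S2).
Proof. by rewrite /fsum big_fsymdiff // => x; apply: fsymdiffxx. Qed.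

Lemma span0 B : span B fset0.
Proof. by exists fset0 => //; rewrite /fsum big_seq_fset0. Qed.

Lemma span_mem B b : B b -> span B b.
Proof.
move=> Bb; exists [fset b]%fset; last by rewrite /fsum big_seq_fset1.
by move=> b'; rewrite inE => /eqP ->.
Qed.

Lemma spanD B z1 z2 : span B z1 -> span B z2 -> span B (fsymdiff z1 z2).
Proof.
move=> [S1 B1 <-] [S2 B2 <-]; exists (fsymdiff S1 S2); last exact: fsumD.
by move=> b; rewrite in_fsymdiff;
  case: (boolP (b \in S1)) => [/B1 // | _]; case: (boolP (b \in S2)) => [/B2|].
Qed.

Lemma span_subset B C z : (forall b, B b -> C b) -> span B z -> span C z.
Proof. by move=> BC [S BS <-]; exists S => // b /BS /BC. Qed.

Lemma big_fsymdiff_closed (I : eqType) (P : {fset T} -> Prop) (s : seq I)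
    (f : I -> {fset T}) :
    P fset0 -> (forall z1 z2, P z1 -> P z2 -> P (fsymdiff z1 z2)) ->
    (forall i, i \in s -> P (f i)) ->
  P (\big[@fsymdiff _/fset0]_(i <- s) f i).
Proof.
move=> P0 PD; elim: s => [_ | i s IH Pf]; first by rewrite big_nil.
rewrite big_cons; apply: PD; first by apply: Pf; rewrite mem_head.
by apply: IH => j js; apply: Pf; rewrite in_cons js orbT.
Qed.

Lemma basis_of_neq0 P B b : basis_of P B -> B b -> b <> fset0.
Proof.
move=> [_ _ indep] Bb b0.
have : b \in [fset b]%fset by rewrite inE.
rewrite (indep [fset b]%fset) ?inE //.
  by move=> b'; rewrite inE => /eqP ->.
by rewrite /fsum big_seq_fset1.
Qed.

Lemma basis_of_set0 : basis_of (fun z => z = fset0) set0.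
Proof.
split=> // [z -> | S S0 _]; first exact: span0.
by apply/fsetP => b; rewrite in_fset0; apply/negP => /S0.
Qed.

Lemma eq_basis_of P Q B : (forall z, P z <-> Q z) -> basis_of P B ->
  basis_of Q B.
Proof.
by move=> PQ [BP spanP indep]; split=> // [b /BP /PQ // | z /PQ /spanP].
Qed.

Lemma fsum_singletons (z : {fset T}) :
  fsum [fset [fset x]%fset | x in z]%fset = z.
Proof.
rewrite /fsum big_imfset /=; last first.
  by move=> x y _ _ /fsetP/(_ x); rewrite !inE eqxx => /esym/eqP.
apply/fsetP => x.
have memD (A A' : {fset T}) :
    (x \in fsymdiff A A') = (x \in A) (+) (x \in A').
  exact: in_fsymdiff.
rewrite (big_morph _ memD (in_fset0 x)).
under eq_bigr do rewrite inE.
have [xz | xz] := boolP (x \in z).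
  rewrite (big_fsetD1 x) //= eqxx big_seq big1 // => y.
  by rewrite !inE eq_sym => /andP[/negbTE].
rewrite big_seq big1 // => y yz; apply/negbTE/eqP => xy.
by rewrite xy yz in xz.
Qed.

(** A set of singletons sums to the set of their elements, so a zero sum is empty. This serves as
    the basis of the quotient when cycles are projected to their chords. *)
Lemma basis_singletons (A : set T) :
  basis_of (fun z => forall x, x \in z -> A x)
           [set [fset x]%fset | x in A]%classic.
Proof.
split=> [b [x Ax <-] y | z Az | S SA S0].
- by rewrite inE => /eqP ->.
- exists [fset [fset x]%fset | x in z]%fset; last exact: fsum_singletons.
  by move=> b /imfsetP[x /= xz ->]; exists x => //; apply: Az.
pose V := [fset x in \bigcup_(b <- S) b | [fset x]%fset \in S]%fset.
have SE : S = [fset [fset x]%fset | x in V]%fset.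
  apply/fsetP => b; apply/idP/imfsetP => [bS | [x /=]].
    have [x _ xb] := SA _ bS; exists x => //=.
    rewrite mem_fset_pred xb bS andbT.
    by apply/bigfcupP; exists b; rewrite ?bS // -xb inE.
  by rewrite mem_fset_pred => /andP[_ xS] ->.
move: S0; rewrite SE fsum_singletons => ->.
by apply/fsetP => b; rewrite in_fset0; apply/negP => /imfsetP[].
Qed.

End LinearAlgebra.

(** The exact sequence is [ker phi -> P -> Q]. *)
Lemma basis_extension (T T' : choiceType) (P : {fset T} -> Prop)
    (Q : {fset T'} -> Prop) (phi : {fset T} -> {fset T'})
    (lift : {fset T'} -> {fset T}) (B : set {fset T'}) (C : set {fset T}) :
    P fset0 -> (forall z1 z2, P z1 -> P z2 -> P (fsymdiff z1 z2)) ->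
    {morph phi : z1 z2 / fsymdiff z1 z2} ->
    (forall z, P z -> Q (phi z)) ->
    basis_of Q B -> (forall b, B b -> P (lift b) /\ phi (lift b) = b) ->
    basis_of (fun z => P z /\ phi z = fset0) C ->
  basis_of P (C `|` [set lift b | b in B])%classic.
Proof.
move=> P0 PD phiD PQ basB liftB [CP spanC indepC].
have [BQ spanB indepB] := basB.
have phi0 : phi fset0 = fset0.
  by rewrite -(fsymdiffxx (fset0 : {fset T})) phiD fsymdiffxx.
split=> [_ [/CP[] // | [b /liftB[Pb _] <-] //] | z Pz | S SBC S0].
- have [S BS Sz] := spanB _ (PQ _ Pz).
  (* Lift the combination that represents [phi z]; the difference of [z] and [y] is then in the
     kernel, which [C] spans. *)
  pose y := \big[@fsymdiff _/fset0]_(b <- S) lift b.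
  have Py : P y.
    by apply: big_fsymdiff_closed => // b /BS /liftB[].
  have phiy : phi y = phi z.
    rewrite -Sz /y (big_morph phi phiD phi0) /fsum big_seq [RHS]big_seq.
    by apply: eq_bigr => b /BS /liftB[].
  rewrite -[z](fsymdiffK y); apply: spanD.
    apply: big_fsymdiff_closed; [exact: span0 | exact: spanD |].
    by move=> b /BS Bb; apply: span_mem; right; exists b.
  apply: (span_subset (B := C)) => [b|]; first by left.
  by apply: spanC; split; [exact: PD | rewrite phiD phiy fsymdiffxx].
(* Members of [S] not killed by [phi] are lifts from [B]. Their images sum to [phi (fsum S)], which
   is empty, so independence of [B] leaves none of them and [S] lies in [C]. *)
pose S1 := [fset s in S | phi s != fset0]%fset.
have S1B s : s \in S1 -> B (phi s) /\ lift (phi s) = s.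
  rewrite mem_fset_pred => /andP[/SBC[/CP[_ ->] | [b Bb <-] _]].
    by rewrite eqxx.
  by have [_ ->] := liftB _ Bb.
have S10 : S1 = fset0.
  have /fsetP img0 : [fset phi s | s in S1]%fset = fset0.
    apply: indepB => [b /imfsetP[s /= /S1B[Bs _] -> //] |].
    rewrite /fsum big_imfset /=; last first.
      by move=> s t /S1B[_ {2}<-] /S1B[_ {2}<-] ->.
    transitivity (phi (fsum S)); last by rewrite S0.
    rewrite /fsum (big_morph phi phiD phi0).
    apply: (big_fset_incl (@fsymdiff T')).
      by apply/fsubsetP => s; rewrite mem_fset_pred => /andP[].
    by move=> s sS; rewrite mem_fset_pred sS /= negbK => /eqP.
  apply/fsetP => s; rewrite in_fset0; apply/negP => sS1.
  by have := img0 (phi s); rewrite in_fset0 in_imfset.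
apply: indepC => // s sS; case: (SBC _ sS) => // -[b Bb bs].
have := in_fset0 s; rewrite -S10 mem_fset_pred sS /= => /negbFE.
have [_ phib] := liftB _ Bb; rewrite -bs phib => /eqP b0.
by case: (basis_of_neq0 basB Bb).
Qed.

(** * Binary cycles: cut parity, simple paths and fundamental circles *)

Section GraphCycles.
Variable X : graph.
Implicit Types (u v x y : vertex X) (w p q : seq (dart X)) (d : dart X).
Implicit Types (e : edge X) (z b : {fset edge X}) (F K D : set (edge X)).

(** The parity of the number of edges of [z] in the cut between [A] and its complement. For [A] a
    single vertex it is the parity of the degree. *)
Definition crossings z (A : vertex X -> bool) : bool :=
  \big[addb/false]_(e <- z) (A (src e) (+) A (tgt e)).

Lemma crossingsD z1 z2 A :
  crossings (fsymdiff z1 z2) A = crossings z1 A (+) crossings z2 A.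
Proof. by rewrite /crossings (big_fsymdiff (op := addb)) //; apply: addbb. Qed.

Lemma crossings1 d A :
  crossings [fset d.1]%fset A = A (dsrc d) (+) A (dtgt d).
Proof.
by rewrite /crossings big_seq_fset1; case: d => e []; rewrite // addbC.
Qed.

Lemma odd_degree z v : odd (degree z v) = crossings z (pred1 v).
Proof.
rewrite /degree (big_morph odd oddD (erefl _)); apply: eq_bigr => e _.
by rewrite oddD !oddb.
Qed.

Lemma binary_cycle_degree z :
  binary_cycle z <-> forall v, crossings z (pred1 v) = false.
Proof.
by split=> zP v; [rewrite -odd_degree; apply/negbTE | rewrite odd_degree zP].
Qed.

(** Sum the degrees over the endpoints of [z] lying in [A]. *)
Lemma binary_cycle_crossings z A : binary_cycle z -> crossings z A = false.
Proof.
move=> /binary_cycle_degree zP.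
pose V := [fset x in [seq src e | e <- z] ++ [seq tgt e | e <- z]]%fset.
have AE x : x \in V -> A x = \big[addb/false]_(u <- V | A u) (x == u).
  move=> xV; rewrite big_mkcond (big_fsetD1 x) //= eqxx big_seq big1 => [|u].
    by case: (A x).
  by rewrite !inE eq_sym => /andP[/negbTE -> _]; case: (A u).
have srcV e : e \in z -> src e \in V.
  by move=> ez; rewrite !inE (map_f (@src X)).
have tgtV e : e \in z -> tgt e \in V.
  by move=> ez; rewrite !inE (map_f (@tgt X)) ?orbT.
have -> : crossings z A = \big[addb/false]_(e <- z)
    \big[addb/false]_(u <- V | A u) ((src e == u) (+) (tgt e == u)).
  rewrite /crossings big_seq [RHS]big_seq; apply: eq_bigr => e ez.
  by rewrite (AE _ (srcV _ ez)) (AE _ (tgtV _ ez)) -big_split.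
by rewrite exchange_big big1 // => u _; apply: zP.
Qed.

Lemma binary_cycle0 : binary_cycle (fset0 : {fset edge X}).
Proof. by move=> v; rewrite /degree big_seq_fset0. Qed.

Lemma binary_cycleD z1 z2 :
  binary_cycle z1 -> binary_cycle z2 -> binary_cycle (fsymdiff z1 z2).
Proof.
move=> /binary_cycle_degree z1P /binary_cycle_degree z2P.
by apply/binary_cycle_degree => v; rewrite crossingsD z1P z2P.
Qed.

Lemma in_edges_mod2 w e :
  (e \in edges_mod2 w) = odd (count_mem e (walk_edges w)).
Proof.
rewrite /edges_mod2 !inE; have [//|] := boolP (e \in walk_edges w).
by move/count_memPn ->.
Qed.

Lemma edges_mod2_nil : edges_mod2 ([::] : seq (dart X)) = fset0.
Proof. by apply/fsetP => e; rewrite in_edges_mod2 in_fset0. Qed.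

Lemma edges_mod2_cons d w :
  edges_mod2 (d :: w) = fsymdiff [fset d.1]%fset (edges_mod2 w).
Proof.
apply/fsetP => e; rewrite in_fsymdiff !in_edges_mod2 /= oddD inE oddb.
by rewrite eq_sym.
Qed.

Lemma edges_mod2_sub w e : e \in edges_mod2 w -> e \in walk_edges w.
Proof. by rewrite /edges_mod2 !inE => /andP[]. Qed.

Lemma mem_edges_mod2 w :
  uniq (walk_edges w) -> edges_mod2 w =i walk_edges w.
Proof. by move=> uw e; rewrite in_edges_mod2 count_uniq_mem // oddb. Qed.

Lemma edges_mod2_uniq w :
  uniq (walk_edges w) -> edges_mod2 w = [fset e in walk_edges w]%fset.
Proof.
by move=> uw; apply/fsetP => e; rewrite mem_edges_mod2 // inE.
Qed.

(** The contributions of consecutive darts telescope. *)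
Lemma walk_crossings u w v A :
  walk u w v -> crossings (edges_mod2 w) A = A u (+) A v.
Proof.
elim: w u => [u /= /eqP -> | d w IH u /= /andP[/eqP <- /IH {}IH]].
  by rewrite edges_mod2_nil /crossings big_seq_fset0 addbb.
by rewrite edges_mod2_cons crossingsD crossings1 IH -addbA addKb.
Qed.

Lemma closed_walk_binary_cycle w : closed_walk w -> binary_cycle (edges_mod2 w).
Proof.
move=> [v vwv]; apply/binary_cycle_degree => x.
by rewrite (walk_crossings _ vwv) addbb.
Qed.

(** The sources of the darts omit the final vertex, so [v] is appended before testing for
    repetition. *)
Definition simple_path u w v : bool :=
  walk u w v && uniq (rcons (map (@dsrc X) w) v).

Lemma walk_vertices u w v d : walk u w v -> d \in w ->
  dsrc d \in rcons (map (@dsrc X) w) v /\ dtgt d \in rcons (map (@dsrc X) w) v.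
Proof.
elim: w u => // d' w IH u /= /andP[_ dw].
rewrite !in_cons => /predU1P[-> | dw'].
  split; first by rewrite eqxx.
  by case: w dw {IH} => [/eqP -> | d2 w /= /andP[/eqP ->]];
    rewrite ?inE eqxx ?orbT.
by have [-> ->] := IH _ dw dw'; rewrite !orbT.
Qed.

(** If the walk used the edge of [d] in either direction, both ends of [d] would be among its
    vertices. *)
Lemma walk_notin u w v d : walk u w v ->
  dsrc d \notin rcons (map (@dsrc X) w) v -> d.1 \notin walk_edges w.
Proof.
move=> uwv; apply: contra => /mapP[d' d'w dd'].
have [] := walk_vertices uwv d'w; case: d d' dd' {d'w} => e [] [e' []] /= -> //.
Qed.

Lemma simple_path_cons u d w v : simple_path u (d :: w) v =
  [&& dsrc d == u, dsrc d \notin rcons (map (@dsrc X) w) v &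
      simple_path (dtgt d) w v].
Proof. by rewrite /simple_path /= -andbA; congr (_ && _); rewrite andbCA. Qed.

Lemma simple_path_uniq_edges u w v : simple_path u w v -> uniq (walk_edges w).
Proof.
elim: w u => // d w IH u; rewrite simple_path_cons => /and3P[_ dn wP] /=.
have /andP[dw _] := wP.
by rewrite (walk_notin dw dn) (IH _ wP).
Qed.

Lemma simple_path_suffix u x p v : simple_path x p v ->
  u \in rcons (map (@dsrc X) p) v ->
  exists2 q, simple_path u q v & {subset q <= p}.
Proof.
elim: p x => [x _ | d p IH x dpP] /=.
  by rewrite inE => /eqP ->; exists [::]; rewrite /simple_path /= ?eqxx.
have := dpP; rewrite simple_path_cons => /and3P[/eqP dx dn pP].
rewrite in_cons => /predU1P[-> | uin]; first by exists (d :: p); rewrite // dx.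
have [q uq qp] := IH _ pP uin.
by exists q => // d' /qp d'p; rewrite in_cons d'p orbT.
Qed.

(** Loop erasure from the end of the walk: when the new first vertex already lies on the path, keep
    only the suffix that starts there. *)
Lemma walk_simple_path u w v : walk u w v ->
  exists2 p, simple_path u p v & {subset p <= w}.
Proof.
elim: w u => [u /= uv | d w IH u /= /andP[/eqP du /IH[p pP pw]]].
  by exists [::]; rewrite /simple_path /= ?uv.
have [uin | un] := boolP (u \in rcons (map (@dsrc X) p) v).
  have [q qP qp] := simple_path_suffix pP uin.
  by exists q => // d' /qp /pw d'w; rewrite in_cons d'w orbT.
exists (d :: p); first by rewrite simple_path_cons du eqxx un.
by move=> d'; rewrite !in_cons => /predU1P[-> | /pw ->]; rewrite ?eqxx ?orbT.
Qed.

(** Opens a circle at one dart. The condition on [d.1] excludes a [w] that merely runs back along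
    the same edge. *)
Lemma simple_closed_walk_cons d w : simple_closed_walk (d :: w) <->
  simple_path (dtgt d) w (dsrc d) /\ d.1 \notin walk_edges w.
Proof.
split=> [[[v /= /andP[/eqP <- dw]] _ /andP[dn uw] /andP[en _]] | [wP en]].
  by split=> //; rewrite /simple_path rcons_uniq; apply/and3P.
have /andP[dw] := wP; rewrite rcons_uniq => uw; split=> //=.
  by exists (dsrc d); rewrite /= eqxx.
by rewrite en (simple_path_uniq_edges wP).
Qed.

(** If [e] were on no circle in [z], the component of its source in [z] minus
    [e] would be left by [e] only, against [binary_cycle_crossings]. *)
Lemma binary_cycle_circle z e : binary_cycle z -> e \in z ->
  exists2 p, simple_closed_walk ((e, true) :: p) &
    forall e', e' \in walk_edges p -> e' \in z /\ e' != e.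
Proof.
move=> zP ez; pose S : set (edge X) := [set e' | e' \in z /\ e' != e]%classic.
have := binary_cycle_crossings (joined S (tgt e)) zP.
rewrite /crossings (big_fsetD1 e) //= big_seq big1 ?addbF => [|e'].
  (* Only the term of [e] is left, so its ends are joined inside [S]; a simple path there closes up
     with [e]. *)
  rewrite (joined_refl S) addbT.
  move=> /negbFE/asboolP[w [/walk_simple_path[p pP pw]]].
  have {}pw e' : e' \in walk_edges p -> e' \in walk_edges w.
    by move=> /mapP[d /pw dw ->]; apply: map_f.
  move=> wS; exists p => [|e' /pw /wS //].
  by apply/simple_closed_walk_cons; split=> //; apply/negP => /pw/wS[_ /eqP].
rewrite !inE => /andP[e'e e'z].
have st : joined S (src e') (tgt e').
  apply/asboolP; exists [:: (e', true)]; rewrite /= /dsrc /dtgt /= !eqxx.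
  by split=> // e2; rewrite inE => /eqP ->.
have -> : joined S (tgt e) (src e') = joined S (tgt e) (tgt e').
  apply/idP/idP => /joined_trans; first exact.
  by apply; rewrite joined_sym.
exact: addbb.
Qed.

(** Take [D] maximal for the first two properties. *)
Lemma maximal_cycle_free F K : exists D,
  [/\ (D `<=` K)%classic,
      forall z, binary_cycle z -> (forall e, e \in z -> F e \/ D e) ->
        forall e, e \in z -> F e &
      forall e, K e -> ~ F e -> ~ D e -> exists2 p,
        simple_closed_walk ((e, true) :: p) &
        forall e', e' \in walk_edges p -> F e' \/ D e'].
Proof.
pose good D := (D `<=` K)%classic /\
  forall z, binary_cycle z -> (forall e, e \in z -> F e \/ D e) ->
    forall e, e \in z -> F e.
have [|D [[DK DF] Dmax]] := @Zorn_bigcup _ good.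
  move=> C Cgood Ctot; split=> [e [D /Cgood[DK _] /DK //] | z zP zC].
  (* By finiteness one member of the chain suffices. The alternative that [F] alone suffices is
     needed for an empty chain. *)
  have fin (s : seq (edge X)) :
      (forall e, e \in s -> F e \/ (\bigcup_(D in C) D)%classic e) ->
      (forall e, e \in s -> F e) \/
      exists2 D, C D & forall e, e \in s -> F e \/ D e.
    elim: s => [_|e s IH sC]; first by left.
    have [] := IH; first by move=> e' e's; apply: sC; rewrite in_cons e's orbT.
      move=> sF; have [Fe | [D CD De]] := sC e (mem_head _ _).
        by left=> e'; rewrite in_cons => /predU1P[-> // | /sF].
      right; exists D => // e'; rewrite in_cons => /predU1P[-> | /sF].
        by right.
      by left.
    move=> [D CD sD]; right; have [Fe | [D' CD' D'e]] := sC e (mem_head _ _).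
      exists D => // e'; rewrite in_cons => /predU1P[-> | /sD //]; by left.
    have [DD' | D'D] := Ctot _ _ CD CD'.
      exists D' => // e'; rewrite in_cons => /predU1P[-> | /sD[]].
          by right.
        by left.
      by move/DD'; right.
    exists D => // e'; rewrite in_cons => /predU1P[-> | /sD //].
    by right; apply: D'D.
  have [// | [D CD zD]] := fin z zC.
  by have [_] := Cgood _ CD; apply.
exists D; split=> // e Ke nFe nDe.
have := Dmax (D `|` [set e])%classic.
case/(_ _)/Wrap => [|ngood].
  by split=> [e' | /(_ e)]; [left | apply/not_implyP; split=> //; right].
(* By maximality, adding [e] creates a cycle not contained in [F]; it must use [e], for otherwise it
   would lie in [F] and [D]. *)
have [z zP [zDe znF]] : exists2 z, binary_cycle z &
    (forall e', e' \in z -> F e' \/ (D `|` [set e])%classic e') /\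
    ~ (forall e', e' \in z -> F e').
  apply: contrapT => nz; apply: ngood; split=> [e' [/DK // | -> //] | z zP zDe].
  by apply: contrapT => znF; apply: nz; exists z.
have ez : e \in z.
  apply: contrapT => nez; apply: znF; apply: (DF z zP) => e' e'z.
  by have [|[|e'e]] := zDe _ e'z; [left | right | rewrite e'e in e'z].
have [p pP pz] := binary_cycle_circle zP ez.
exists p => // e' /pz[e'z /eqP e'e].
by have [|[|]] := zDe _ e'z; [left | right | ].
Qed.

(** Relative form of fundamental circles: [D] acts as a spanning forest over [F], and each further
    edge of [K] is a chord closed by one circle. Projecting cycles to their chords kills exactly the
    cycles in [F] and sends each chosen circle to a singleton, so [basis_extension] applies. *)
Lemma basis_chords F K (B : set {fset edge X}) : (F `<=` K)%classic ->
    exists D (p : edge X -> seq (dart X)),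
    (forall e, K e -> ~ F e -> ~ D e ->
      simple_closed_walk ((e, true) :: p e) /\
      forall e', e' \in walk_edges (p e) -> F e' \/ D e') /\
    (basis_of (fun z => binary_cycle z /\ forall e, e \in z -> F e) B ->
     basis_of (fun z => binary_cycle z /\ forall e, e \in z -> K e)
       (B `|` [set edges_mod2 ((e, true) :: p e) |
               e in [set e | [/\ K e, ~ F e & ~ D e]]])%classic).
Proof.
move=> FK; have [D [DK DF chord]] := maximal_cycle_free F K.
pose N : set (edge X) := [set e | [/\ K e, ~ F e & ~ D e]]%classic.
have /choice[p pP] e : exists q, N e -> simple_closed_walk ((e, true) :: q) /\
    forall e', e' \in walk_edges q -> F e' \/ D e'.
  have [[Ke nFe nDe] | nNe] := pselect (N e); last by exists [::].
  by have [q qP qFD] := chord e Ke nFe nDe; exists q.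
exists D, p; split=> [e Ke nFe nDe | basB]; first exact: pP.
pose C e := edges_mod2 ((e, true) :: p e).
have CE e e' : N e -> e' \in C e -> F e' \/ D e' \/ e' = e.
  move=> Ne /edges_mod2_sub; rewrite /= in_cons => /predU1P[|].
    by right; right.
  by move=> /(pP _ Ne).2[]; [left | right; left].
pose phi z := [fset e in z | `[<N e>]]%fset.
have phiD : {morph phi : z1 z2 / fsymdiff z1 z2}.
  move=> z1 z2; apply/fsetP => e.
  by rewrite in_fsymdiff !mem_fset_pred in_fsymdiff andb_addl.
have phiC e : N e -> phi (C e) = [fset e]%fset.
  move=> Ne; apply/fsetP => e'; rewrite mem_fset_pred inE.
  apply/andP/eqP => [[/(CE _ _ Ne) + /asboolP[_ nFe' nDe']] | ->].
    by move=> [|[|]].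
  split; last exact/asboolP.
  have [/simple_closed_walk_cons[_ nin] _] := pP _ Ne.
  by rewrite in_edges_mod2 /= eqxx (count_memPn nin).
(* The lift must be a function of arbitrary finite sets; those that are not singletons get the
   default [fset0]. *)
have /choice[lift liftE] b : exists c, forall e, b = [fset e]%fset -> c = C e.
  have [[e ->] | nb] := pselect (exists e, b = [fset e]%fset).
    by exists (C e) => e' /fsetP/(_ e); rewrite !inE eqxx => /esym/eqP ->.
  by exists fset0 => e be; case: nb; exists e.
have -> : [set C e | e in N]%classic =
    [set lift b | b in [set [fset e]%fset | e in N]]%classic.
  apply/seteqP; split=> [_ [e Ne <-] | _ [_ [e Ne <-] <-]].
    by exists [fset e]%fset; [exists e | apply: liftE].
  by exists e => //; rewrite (liftE _ e).
apply: (basis_extension (phi := phi) (Q := fun z => forall e, e \in z -> N e)).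
- by split=> //; apply: binary_cycle0.
- move=> z1 z2 [z1P z1K] [z2P z2K]; split; first exact: binary_cycleD.
  move=> e; rewrite in_fsymdiff.
  by have [/z1K // | _ /=] := boolP (e \in z1); apply: z2K.
- exact: phiD.
- by move=> z _ e; rewrite mem_fset_pred => /andP[_ /asboolP].
- exact: basis_singletons.
- move=> _ [e Ne <-]; rewrite (liftE _ e) // phiC //; split=> //; split.
    by have [[cw _ _ _] _] := pP _ Ne; apply: closed_walk_binary_cycle.
  move=> e' /(CE _ _ Ne)[/FK // | [/DK // | ->]].
  by case: Ne.
apply: eq_basis_of basB => z; split=> [[zP zF] | [[zP zK] phiz]].
  split; first by split=> // e /zF /FK.
  apply/fsetP => e; rewrite mem_fset_pred in_fset0; apply/negP.
  by move=> /andP[/zF Fe /asboolP[]].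
split=> //; apply: DF => // e ez; apply: contrapT => /not_orP[nFe nDe].
have := in_fset0 e; rewrite -phiz mem_fset_pred ez /= => /asboolP; apply.
by split=> //; apply: zK.
Qed.

End GraphCycles.

(** * Gains of walks, and the two tests in terms of functions on edges *)

Section WalkGain.
Variables (X : graph) (G : groupType).
Implicit Types (h : edge X -> G) (w : seq (dart X)).

Definition dart_gain h (d : dart X) : G := if d.2 then h d.1 else (h d.1)^-1.

Definition walk_gain h w : G := \prod_(d <- w) dart_gain h d.

Lemma gainE (g : gain_function X G) w :
  gain g w = walk_gain (fun e => g (fg_gen e)) w.
Proof.
apply: eq_bigr => -[e b] _; rewrite /dart_elt /dart_gain /=.
case: b => //; apply: (mulgI (g (fg_gen e))).
(* What remains is [g 1 = 1], obtained by cancelling in [g 1 * g 1 = g 1]. *)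
by rewrite -gmulfM !mulgV; apply: (mulgI (g 1)); rewrite -gmulfM !mulg1.
Qed.

Lemma walk_gain_free_eq h w1 w2 :
  free_eq w1 w2 -> walk_gain h w1 = walk_gain h w2.
Proof.
elim=> {w1 w2} [// | // | w1 w2 w3 _ -> _ -> // | w1 [e b] w2].
rewrite /walk_gain !big_cat !big_cons /dart_gain /=; congr (_ * _).
by rewrite mulgA; case: b; rewrite ?mulgV ?mulVg mul1g.
Qed.

(** The universal property of the free group: the gain of a representative word depends only on its
    class, by [walk_gain_free_eq]. *)
Lemma gain_function_of h :
  exists g : gain_function X G, forall e, g (fg_gen e) = h e.
Proof.
pose k (x : free_group (edge X)) : G := walk_gain h (repr x).
have kM : {morph k : x y / x * y}.
  elim/quotW=> u; elim/quotW=> v.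
  rewrite [_ * _](pi_mul u v) /k /walk_gain -big_cat.
  apply: walk_gain_free_eq; apply: free_eq_trans (free_eq_repr _) _.
  by apply: free_eq_cat; apply/free_eq_sym/free_eq_repr.
pose km := isMultiplicative.Build _ _ k kM.
pose g : {multiplicative free_group (edge X) -> G} := HB.pack k km.
exists g => e; rewrite /= /k.
rewrite (walk_gain_free_eq h (free_eq_repr _)).
by rewrite /walk_gain big_seq1.
Qed.

Lemma walk_gain1 w : walk_gain (fun=> 1) w = 1.
Proof.
by rewrite /walk_gain big1 // => -[e b] _; case: b; rewrite /dart_gain ?invg1.
Qed.

Lemma eq_walk_gain h1 h2 w : (forall e, e \in walk_edges w -> h1 e = h2 e) ->
  walk_gain h1 w = walk_gain h2 w.
Proof.
move=> h12; apply: eq_big_seq => d dw.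
by rewrite /dart_gain h12 // map_f.
Qed.

End WalkGain.

(** The two tests at once: [c] selects the Circle Test. *)
Definition test_orientation (c : bool) (X : graph) (b : {fset edge X})
    (w : seq (dart X)) : Prop :=
  cyclic_orientation b w /\ (c -> simple_closed_walk w).

(** The orientation of [B] is replaced by a separate witness for each member; the axiom of choice
    reassembles them in [test_validE]. *)
Definition test_valid (c : bool) (X : graph) (G : groupType)
    (h : edge X -> G) : Prop :=
  forall B, is_basis B ->
    (forall b, B b -> exists2 w, test_orientation c b w & walk_gain h w = 1) ->
  forall w : seq (dart X), simple_closed_walk w -> walk_gain h w = 1.

Lemma circle_orientation_mod2 (X : graph) (b : {fset edge X}) w :
  circle_orientation b w <-> test_orientation true b w.
Proof.
split=> [[sw <-] | [[cw <-] /(_ isT) sw]].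
  by have [cw _ _ uw] := sw; split=> //; split=> //; apply: edges_mod2_uniq.
by split=> //; have [_ _ _ uw] := sw; rewrite -edges_mod2_uniq.
Qed.

Lemma test_validE (c : bool) (X : graph) (G : groupType)
    (g : gain_function X G) :
  (if c then circle_test_valid g else binary_cycle_test_valid g) <->
  test_valid c (fun e => g (fg_gen e)).
Proof.
have tildeP (B : set {fset edge X}) :
    (forall b, B b -> exists2 w, test_orientation c b w &
       walk_gain (fun e => g (fg_gen e)) w = 1) ->
    exists tilde, (forall b, B b -> test_orientation c b (tilde b)) /\
      (forall b, B b -> gain g (tilde b) = 1).
  move=> Bw; have /choice[t tP] b : exists w, B b ->
      test_orientation c b w /\ gain g w = 1.
    have [/Bw[w bw w1] | nBb] := pselect (B b); last by exists [::].
    by exists w; rewrite gainE.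
  by exists t; split=> b /tP[].
case: c tildeP => tildeP; split.
- move=> valid B basB /tildeP[t [tB t1]] w sw; rewrite -gainE.
  apply: valid sw; exists B => //; split=> [b /tB/circle_orientation_mod2 bt|].
    by exists (t b).
  by exists t; split=> // b /tB/circle_orientation_mod2.
- move=> valid [B basB [_ [t [tB t1]]]] w sw; rewrite gainE.
  apply: valid basB _ w sw => b Bb; exists (t b); last by rewrite -gainE t1.
  exact/circle_orientation_mod2/tB.
- move=> valid B basB /tildeP[t [tB t1]] w sw; rewrite -gainE.
  by apply: valid sw; exists B => //; exists t; split=> // b /tB[].
- move=> valid [B basB [t [tB t1]]] w sw; rewrite gainE.
  apply: valid basB _ w sw => b Bb; exists (t b); last by rewrite -gainE t1.
  by split=> //; apply: tB.
Qed.

(** * Preimages of finite sets under an injection *)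

Section PartialInverse.
Variables (T T' : choiceType) (f : T' -> T).
Hypothesis f_inj : injective f.

Definition partial_inv (x : T) : option T' :=
  if pselect (exists y, f y = x) is left ex then Some (projT1 (cid ex))
  else None.

Lemma partial_invK : pcancel f partial_inv.
Proof.
move=> y; rewrite /partial_inv; case: pselect => [ex | []]; last by exists y.
by congr Some; apply: f_inj; case: (cid ex).
Qed.

Lemma partial_inv_some x y : partial_inv x = Some y -> f y = x.
Proof.
by rewrite /partial_inv; case: pselect => // ex [<-]; case: (cid ex).
Qed.

Lemma partial_inv_none x : partial_inv x = None -> forall y, f y <> x.
Proof.
by rewrite /partial_inv; case: pselect => // nex _ y yx; apply: nex; exists y.
Qed.

Definition fset_preim (z : {fset T}) : {fset T'} :=
  [fset y in pmap partial_inv z]%fset.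

Lemma in_fset_preim z y : (y \in fset_preim z) = (f y \in z).
Proof.
rewrite inE mem_pmap; apply/mapP/idP => [[x xz /esym/partial_inv_some ->] //|].
by exists (f y); rewrite ?partial_invK.
Qed.

Lemma fset_preimD : {morph fset_preim : z1 z2 / fsymdiff z1 z2}.
Proof.
move=> z1 z2; apply/fsetP => y.
by rewrite in_fsymdiff !in_fset_preim in_fsymdiff.
Qed.

Lemma big_fset_preim (M : Type) (idx : M) (op : Monoid.com_law idx)
    (z : {fset T}) (k : T -> M) :
    (forall x, x \in z -> partial_inv x = None -> k x = idx) ->
  \big[op/idx]_(y <- fset_preim z) k (f y) = \big[op/idx]_(x <- z) k x.
Proof.
move=> kidx.
transitivity (\big[op/idx]_(x <- [fset f y | y in fset_preim z]%fset) k x).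
  by rewrite [RHS]big_imfset //= => y1 y2 _ _ /f_inj.
apply: big_fset_incl => [|x xz].
  by apply/fsubsetP => _ /imfsetP[y /= + ->]; rewrite in_fset_preim.
case Ex : (partial_inv x) => [y|]; last by rewrite kidx.
move: xz; rewrite -(partial_inv_some Ex) -in_fset_preim => yz.
by rewrite in_imfset.
Qed.

End PartialInverse.

(** * Transfer of the tests to a minor *)

(** [Y] as a minor of [X]: [f] embeds the edges, [flip] records reversed
    orientations, and [F] consists of the edges not deleted, so that the
    contracted edges are those of [F] outside the image of [f]. *)
Section MinorModel.
Variables (X Y : graph) (f : edge Y -> edge X) (flip : edge Y -> bool).
Variable F : set (edge X).
Hypothesis f_inj : injective f.

(** The value [None] marks a dart outside the image of [f], so [pmap proj_dart] erases such darts
    from a walk. *)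
Definition proj_dart (d : dart X) : option (dart Y) :=
  omap (fun e => (e, d.2 (+) flip e)) (partial_inv f d.1).

(** The default 1 outside the image of [f] makes the erased darts irrelevant to the gain. *)
Definition pull_gain (G : groupType) (h : edge Y -> G) (e : edge X) : G :=
  if partial_inv f e is Some e' then if flip e' then (h e')^-1 else h e'
  else 1.

Lemma walk_gain_proj (G : groupType) (h : edge Y -> G) w :
  walk_gain (pull_gain h) w = walk_gain h (pmap proj_dart w).
Proof.
rewrite /walk_gain; elim: w => [|[e b] w IH] /=; first by rewrite !big_nil.
rewrite big_cons IH /dart_gain /pull_gain /proj_dart /=.
case: (partial_inv f e) => [e'|] /=; last by case: b; rewrite ?invg1 mul1g.
by rewrite big_cons /=; case: b; case: (flip e'); rewrite ?invgK.
Qed.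

Lemma edges_mod2_proj w :
  edges_mod2 (pmap proj_dart w) = fset_preim f (edges_mod2 w).
Proof.
elim: w => [|d w IH]; apply/fsetP => e.
  by rewrite in_fset_preim // !edges_mod2_nil !in_fset0.
rewrite edges_mod2_cons fset_preimD // -IH in_fsymdiff in_fset_preim // inE.
case Ed : (partial_inv f d.1) => [e'|].
  have -> : pmap proj_dart (d :: w) = (e', d.2 (+) flip e') :: pmap proj_dart w.
    by rewrite /= [proj_dart d]/proj_dart Ed.
  rewrite edges_mod2_cons in_fsymdiff inE -(partial_inv_some Ed).
  by rewrite (inj_eq f_inj).
have -> : pmap proj_dart (d :: w) = pmap proj_dart w.
  by rewrite /= [proj_dart d]/proj_dart Ed.
suff /eqP/negbTE -> : f e <> d.1 by [].
exact: partial_inv_none Ed e.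
Qed.

Hypothesis walk_lift : forall w : seq (dart Y), closed_walk w -> exists L,
  [/\ closed_walk L, forall e, e \in walk_edges L -> F e,
      pmap proj_dart L = w & simple_closed_walk w -> simple_closed_walk L].
Hypothesis binary_cycle_proj : forall z : {fset edge X},
  binary_cycle z -> (forall e, e \in z -> F e) -> binary_cycle (fset_preim f z).

Lemma minor_test_valid (c : bool) (G : groupType) :
    (forall h : edge X -> G, test_valid c h) ->
  forall h : edge Y -> G, test_valid c h.
Proof.
move=> valid h B basB Bw w sw.
(* [S] consists of the contracted edges. Their cycle space gets a basis of circles by adding chords
   over the empty edge set. *)
pose S : set (edge X) := [set e | F e /\ partial_inv f e = None]%classic.
have [|D0 [p0 [p0P /(_ _)/Wrap basS]]] := @basis_chords X set0 S set0.
  by move=> e.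
case: basS => [|basS].
  apply: eq_basis_of (basis_of_set0 _) => z; split=> [-> | [_ z0]].
    by split; [apply: binary_cycle0 | move=> e; rewrite in_fset0].
  by apply/fsetP => e; rewrite in_fset0; apply/negP => /z0.
set B0 := (_ `|` _)%classic in basS.
pose h0 := pull_gain h.
have h0S e : partial_inv f e = None -> h0 e = 1 by rewrite /h0 /pull_gain => ->.
(* The lift of [b] is the reduction modulo 2 of a lifted orientation [L]; it may contain contracted
   edges, which have gain 1. *)
have /choice[t tP] b : exists L, B b ->
    [/\ test_orientation c (edges_mod2 L) L,
        forall e, e \in walk_edges L -> F e,
        fset_preim f (edges_mod2 L) = b & walk_gain h0 L = 1].
  have [/Bw[v [[cv vb] sv] v1] | nBb] := pselect (B b); last by exists [::].
  have [L [cL LF Lv sL]] := walk_lift cv; exists L => _; split=> //.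
  - by split=> // /sv /sL.
  - by rewrite -edges_mod2_proj Lv.
  - by rewrite /h0 walk_gain_proj Lv.
pose B1 := (B0 `|` [set edges_mod2 (t b) | b in B])%classic.
(* Among the cycles in [F], the projection to [Y] kills exactly those in [S], so [B0] and the lifts
   of [B] combine by [basis_extension]. *)
have basF : basis_of
    (fun z : {fset edge X} => binary_cycle z /\ forall e, e \in z -> F e) B1.
  apply: (basis_extension (phi := fset_preim f)) basB _ _ => //.
  - by split=> //; apply: binary_cycle0.
  - move=> z1 z2 [z1P z1F] [z2P z2F]; split; first exact: binary_cycleD.
    move=> e; rewrite in_fsymdiff.
    by have [/z1F // | _ /=] := boolP (e \in z1); apply: z2F.
  - exact: fset_preimD.
  - by move=> z [zP zF]; apply: binary_cycle_proj.
  - move=> b /tP[[[ct _] _] tF tb _]; split=> //; split.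
      exact: closed_walk_binary_cycle.
    by move=> e /edges_mod2_sub /tF.
  apply: eq_basis_of basS => z; split=> [[zP zS] | [[zP zF] z0]].
    split; first by split=> // e /zS[].
    apply/fsetP => e; rewrite in_fset_preim // in_fset0; apply/negP => /zS[_].
    by rewrite partial_invK.
  split=> // e ez; split; first exact: zF.
  case Ee : (partial_inv f e) => [e'|] //; have := in_fset0 e'.
  by rewrite -z0 in_fset_preim // (partial_inv_some Ee) ez.
have [//|D [p [pP /(_ basF) bas]]] := @basis_chords X F setT B1.
(* Each remaining edge gets the gain that balances its circle. There is no circularity, because
   [p e] runs only through [F] and [D], where [h1] is [h0]. *)
pose h1 e := if `[<F e \/ D e>] then h0 e else (walk_gain h0 (p e))^-1.
have h1E v : (forall e, e \in walk_edges v -> F e \/ D e) ->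
    walk_gain h1 v = walk_gain h0 v.
  by move=> vFD; apply: eq_walk_gain => e /vFD /asboolP; rewrite /h1 => ->.
have [L [cL LF Lw /(_ sw) sL]] := walk_lift (let: And4 cw _ _ _ := sw in cw).
rewrite -Lw -walk_gain_proj -/h0 -h1E; last by move=> e /LF; left.
have basX : is_basis (B1 `|` [set edges_mod2 ((e, true) :: p e) | e in
    [set e | [/\ [set: edge X] e, ~ F e & ~ D e]]])%classic.
  by apply: eq_basis_of bas => z; split=> [[]|].
(* Three kinds of basis members: circles of contracted edges, where every edge has gain 1; lifts
   from [Y]; and circles closed by a chord over [F] and [D], balanced by the choice of [h1]. *)
apply: (valid h1 _ basX) sL => b [[B0b | [b0 Bb0 <-]] | [e [_ nFe nDe] <-]].
- have [_ bS] := let: And3 B0P _ _ := basS in B0P _ B0b.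
  case: B0b => // -[e [Se _ nDe] be]; have [s0 _] := p0P e Se id nDe.
  have [c0 _ _ u0] := s0; exists ((e, true) :: p0 e) => //.
  have p0S e' : e' \in walk_edges ((e, true) :: p0 e) -> S e'.
    by move=> e'p; apply: bS; rewrite -be mem_edges_mod2.
  rewrite h1E => [|e' /p0S[] //]; last by left.
  by rewrite (@eq_walk_gain _ _ _ (fun=> 1)) ?walk_gain1 // => e' /p0S[_ /h0S].
- have [ob tF _ tb1] := tP _ Bb0; exists (t b0) => //.
  by rewrite h1E // => e /tF; left.
have [sp pFD] := pP e I nFe nDe; exists ((e, true) :: p e).
  by split=> //; split=> //; case: sp.
rewrite /walk_gain big_cons -/(walk_gain h1 _) h1E // /dart_gain /= /h1.
by case: asboolP => [[]// | _]; rewrite mulVg.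
Qed.

End MinorModel.

(** * Contractions: lifting walks and projecting cycles *)

Section ContractionLift.
Variables (X : graph) (S : set (edge X)).
Let Y := contract S.
Let cls (x : vertex X) : vertex Y := \pi_{eq_quot (joined S)} x.
Let f (e : edge Y) : edge X := val e.
Let proj := proj_dart f (fun=> false).

Lemma contract_edge_inj : injective f.
Proof. exact: val_inj. Qed.

Lemma cls_joined x y : cls x = cls y <-> joined S x y.
Proof. by split=> [/eqquotP | xy]; last apply/eqquotP. Qed.

Lemma proj_contracted w : (forall e, e \in walk_edges w -> S e) ->
  pmap proj w = [::].
Proof.
elim: w => //= d w IH wS; rewrite IH => [|e ew]; last first.
  by apply: wS; rewrite in_cons ew orbT.
rewrite [proj d]/proj /proj_dart; case Ed : (partial_inv f d.1) => [e|] //.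
have /= := set_mem (valP e); rewrite -[val e]/(f e) (partial_inv_some Ed).
by case; apply: wS; rewrite mem_head.
Qed.

(** The connecting piece of a lifted walk. Its vertices stay in one class, so it cannot meet a piece
    in another class. *)
Lemma joined_simple_path x y : joined S x y -> exists p,
  [/\ simple_path x p y, pmap proj p = [::] &
      forall z, z \in rcons (map (@dsrc X) p) y -> cls z = cls y].
Proof.
move=> /asboolP[w [/walk_simple_path[p pP pw] wS]].
have pS e : e \in walk_edges p -> S e.
  by move=> /mapP[d /pw dw ->]; apply: wS; apply: map_f.
exists p; split=> //; first exact: proj_contracted.
have /andP[xp _] := pP; elim: p x xp pS {pP pw} => [|d p IH] x.
  by move=> _ _ z; rewrite inE => /eqP ->.
move=> /= /andP[_ dp] pS; have dpS e : e \in walk_edges p -> S e.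
  by move=> ep; apply: pS; rewrite in_cons ep orbT.
move=> z; rewrite in_cons => /predU1P[-> | ]; last exact: (IH _ dp dpS).
apply/cls_joined/asboolP; exists (d :: p); split=> //.
by rewrite /= eqxx.
Qed.

Lemma cls_dart (e : edge Y) (b : bool) :
  cls (dsrc (f e, b)) = dsrc (e, b) /\ cls (dtgt (f e, b)) = dtgt (e, b).
Proof. by case: b. Qed.

(** Between consecutive darts insert a simple path inside the contracted
    component; distinct vertices of the contraction are disjoint components. *)
Lemma contract_walk_lift (w : seq (dart Y)) u v x y :
    walk u w v -> cls x = u -> cls y = v -> exists L,
  [/\ walk x L y, pmap proj L = w,
      uniq (rcons (map (@dsrc Y) w) v) -> simple_path x L y &
      forall z, z \in rcons (map (@dsrc X) L) y ->
        cls z \in rcons (map (@dsrc Y) w) v].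
Proof.
elim: w u x => [|[e b] w IH] u x /=.
  move=> /eqP <- xu yu.
  have /cls_joined/joined_simple_path[p [pP p0 pv]] : cls x = cls y.
    by rewrite xu yu.
  exists p; split=> //; first by case/andP: pP.
  by move=> z /pv ->; rewrite inE yu.
move=> /andP[/eqP du dw] xu yv.
pose d : dart X := (f e, b).
have [clsd clsd'] : cls (dsrc d) = _ /\ cls (dtgt d) = _ := cls_dart e b.
have [L [dL Lw Lu Lv]] := IH _ (dtgt d) dw clsd' yv.
have /cls_joined/joined_simple_path[p [pP p0 pd]] : cls x = cls (dsrc d).
  by rewrite xu -du clsd.
have vE : rcons (map (@dsrc X) (p ++ d :: L)) y =
    rcons (map (@dsrc X) p) (dsrc d) ++ rcons (map (@dsrc X) L) y.
  by rewrite map_cat /= rcons_cat /= cat_rcons.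
have /andP[xp up] := pP.
have walkL : walk x (p ++ d :: L) y by apply: walk_cat xp _; rewrite /= eqxx.
exists (p ++ d :: L); split=> //.
- rewrite pmap_cat p0 /= [proj d]/proj /proj_dart /= partial_invK ?Lw //.
    by rewrite addbF.
  exact: contract_edge_inj.
- move=> /andP[dn /Lu /andP[_ uL]].
  rewrite /simple_path walkL vE cat_uniq up uL andbT.
  apply/hasPn => z /Lv zw; apply: contra dn => /pd zd.
  by rewrite -clsd -zd.
move=> z; rewrite vE mem_cat in_cons => /orP[/pd -> | /Lv ->].
  by rewrite clsd eqxx.
by rewrite orbT.
Qed.

(** The first dart is lifted as it is, and the rest as a walk from its target back to its source;
    for a simple closed walk this rest is a simple path and lifts to one. *)
Lemma contract_closed_walk_lift (w : seq (dart Y)) : closed_walk w -> exists L,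
  [/\ closed_walk L, forall e, e \in walk_edges L -> setT e,
      pmap proj L = w & simple_closed_walk w -> simple_closed_walk L].
Proof.
case: w => [[v _] | [e b] w [v /= /andP[/eqP dv dw]]].
  by exists [::]; split=> //; [exists (repr v) => /= | case].
pose d : dart X := (f e, b).
have [clsd clsd'] : cls (dsrc d) = _ /\ cls (dtgt d) = _ := cls_dart e b.
have [L [dL Lw Lu _]] := contract_walk_lift dw clsd' (etrans clsd dv).
have proj_d : pmap proj (d :: L) = (e, b) :: w.
  rewrite /= [proj d]/proj /proj_dart /= partial_invK ?Lw ?addbF //.
  exact: contract_edge_inj.
exists (d :: L); split=> //; first by exists (dsrc d); rewrite /= eqxx.
move=> /simple_closed_walk_cons[/andP[_ uw] en]; apply/simple_closed_walk_cons.
split; first by apply: Lu; rewrite -dv.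
(* If [L] used the edge of [d] again, that edge would survive the projection and occur in [w]. *)
apply: contra en => /mapP[[e' b'] e'L /= ee']; apply/mapP.
exists (e, b') => //; rewrite -Lw mem_pmap; apply/mapP; exists (e', b') => //.
rewrite -ee' /proj /proj_dart /= partial_invK ?addbF //.
exact: contract_edge_inj.
Qed.

(** The degree at a vertex [v] of the contraction has the parity of the cut around the class [v] in
    [X], since contracted edges have both ends in one class. *)
Lemma contract_binary_cycle (z : {fset edge X}) :
  binary_cycle z -> binary_cycle (fset_preim f z).
Proof.
move=> zP; apply/binary_cycle_degree => v.
transitivity (crossings z (fun x => cls x == v)).
  2: exact: binary_cycle_crossings.
rewrite /crossings -(big_fset_preim contract_edge_inj) // => e _.
move=> /partial_inv_none eS.
have -> : cls (src e) = cls (tgt e); last exact: addbb.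
apply/cls_joined/asboolP; exists [:: (e, true)].
split=> [|e']; first by rewrite /= !eqxx.
rewrite inE => /eqP ->; apply: contrapT => nSe.
by apply: (eS (exist _ e (mem_set nSe))).
Qed.

Lemma contract_test_valid (c : bool) (G : groupType) :
    (forall h : edge X -> G, test_valid c h) ->
  forall h : edge Y -> G, test_valid c h.
Proof.
apply: (minor_test_valid (flip := fun=> false) (F := setT)) => //.
- exact: contract_edge_inj.
- exact: contract_closed_walk_lift.
- by move=> z zP _; apply: contract_binary_cycle.
Qed.

End ContractionLift.

(** * Subgraphs and isomorphisms, treated as embeddings *)

Section Embedding.
Variables (X Y : graph) (fV : vertex Y -> vertex X) (f : edge Y -> edge X).
Hypotheses (fV_inj : injective fV) (f_inj : injective f).
Hypothesis f_ends : forall e,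
  (src (f e) = fV (src e) /\ tgt (f e) = fV (tgt e)) \/
  (src (f e) = fV (tgt e) /\ tgt (f e) = fV (src e)).

(** A loop fits both cases of [f_ends] and counts as not flipped. *)
Let flip (e : edge Y) : bool :=
  (src (f e), tgt (f e)) != (fV (src e), fV (tgt e)).

Let emb (d : dart Y) : dart X := (f d.1, d.2 (+) flip d.1).

Lemma dart_embedding d :
  dsrc (emb d) = fV (dsrc d) /\ dtgt (emb d) = fV (dtgt d).
Proof.
case: d => e b; rewrite /emb /dsrc /dtgt /= /flip xpair_eqE.
have [[se te] | [se te]] := f_ends e.
  by rewrite se te !eqxx /= addbF; case: b.
rewrite se te !(inj_eq fV_inj) [tgt e == _]eq_sym andbb.
by have [-> | _] := eqVneq (src e) (tgt e); case: b.
Qed.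

Lemma walk_embedding u w v : walk u w v -> walk (fV u) (map emb w) (fV v).
Proof.
elim: w u => [u /= /eqP -> // | d w IH u /= /andP[/eqP <- /IH]].
by have [-> ->] := dart_embedding d; rewrite eqxx.
Qed.

Lemma embedding_closed_walk_lift (w : seq (dart Y)) : closed_walk w -> exists L,
  [/\ closed_walk L, forall e, e \in walk_edges L -> range f e,
      pmap (proj_dart f flip) L = w &
      simple_closed_walk w -> simple_closed_walk L].
Proof.
move=> [v vwv]; have cL : closed_walk (map emb w).
  by exists (fV v); apply: walk_embedding.
exists (map emb w); split=> //.
- by move=> e; rewrite /walk_edges -map_comp => /mapP[d _ ->]; exists d.1.
- apply: (map_pK (g := emb)) => -[e b].
  by rewrite /proj_dart /= partial_invK //= -addbA addbb addbF.
move=> [_ w0 us ue]; split=> //.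
- by case: (w) w0.
- rewrite -map_comp (eq_map (g := fV \o @dsrc Y)) => [|d].
    by rewrite map_comp map_inj_uniq.
  by have [] := dart_embedding d.
by rewrite /walk_edges -map_comp (map_comp f fst) map_inj_uniq.
Qed.

Lemma embedding_binary_cycle (z : {fset edge X}) : binary_cycle z ->
  (forall e, e \in z -> range f e) -> binary_cycle (fset_preim f z).
Proof.
move=> /binary_cycle_degree zP zf; apply/binary_cycle_degree => v.
transitivity (crossings z (pred1 (fV v))) => //.
rewrite /crossings -(big_fset_preim f_inj) => [|e /zf[e' _ <-]].
  apply: eq_bigr => e _ /=.
  by have [[-> ->] | [-> ->]] := f_ends e; rewrite !(inj_eq fV_inj) // addbC.
by rewrite partial_invK.
Qed.

(** Nothing is contracted here, so the edges that are not deleted are just the range of [f]. *)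
Lemma embedding_test_valid (c : bool) (G : groupType) :
    (forall h : edge X -> G, test_valid c h) ->
  forall h : edge Y -> G, test_valid c h.
Proof.
apply: (minor_test_valid (flip := flip) (F := range f) f_inj).
- exact: embedding_closed_walk_lift.
- exact: embedding_binary_cycle.
Qed.

End Embedding.

(** * Minor closure, by induction on the sequence of operations *)

Lemma test_valid_minor_closed (GG : groupType -> Prop) (c : bool) :
  minor_closed (fun X => forall G, GG G ->
    forall h : edge X -> G, test_valid c h).
Proof.
move=> X Y XP XY G GGG.
elim: XY => {Y} [|Y S _ IH|Y W F srcW tgtW _ IH|Y Z _ IH].
- exact: XP.
- exact: contract_test_valid IH.
- apply: (@embedding_test_valid Y (subgraph srcW tgtW) val val) IH => //.
  + exact: val_inj.
  + exact: val_inj.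
  + by move=> e; left.
(* An isomorphism from [Y] to [Z] is used through its inverse, which embeds [Z] into [Y]. *)
move=> [fV [fE [[kV fVK kVK] [kE fEK kEK] ends]]].
apply: (embedding_test_valid (can_inj kVK) (can_inj kEK)) IH => e.
have [[]|[]] := ends (kE e); rewrite kEK => -> ->; rewrite !fVK.
  by left.
by right.
Qed.

Theorem theorem3p1 (GG : groupType -> Prop) :
  minor_closed (fun X : graph =>
    forall G : groupType, GG G ->
    forall g : gain_function X G, binary_cycle_test_valid g) /\
  minor_closed (fun X : graph =>
    forall G : groupType, GG G ->
    forall g : gain_function X G, circle_test_valid g).
Proof.
have test c : minor_closed (fun X : graph => forall G : groupType, GG G ->
    forall g : gain_function X G,
      if c then circle_test_valid g else binary_cycle_test_valid g).
  move=> X Y XP XY G GGG g; apply/test_validE.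
  apply: (test_valid_minor_closed (GG := GG) _ XY) => // G' GG' h.
  (* The function [h] on the edges of [X] must be realised by a gain function before the assumption
     on [X] applies. *)
  have [g' g'h] := gain_function_of h.
  by have /test_validE := XP G' GG' g'; rewrite (funext g'h).
by split; [exact: (test false) | exact: (test true)].
Qed.
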